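(* Let $(\mathcal{C},\mathbb{E},\mathfrak{s})$ be an extriangulated category with products. Consider the following statements. (a) $\mathcal{C}$ is AET4*. (b) For any set $I\neq\emptyset$, the map $\tau:\mathbb{E}(A,\prod_{i\in I}B_i)\to\prod_{i\in I}\mathbb{E}(A,B_i)$, $\epsilon\mapsto(\pi_i^B\cdot\epsilon)_{i\in I}$, defines a natural isomorphism (where $\{B_i\}_{i\in I}$ is any family of objects, $A$ any object of $\mathcal{C}$, and $\pi_i^B:\prod_{i\in I}B_i\to B_i$ are the canonical projections). (c) For any objects $V,D$ in $\mathcal{C}$ there is a universal $\mathbb{E}$-coextension of $V$ by $D$; that is, there are a set $X\neq\emptyset$ and an $\eta\in\mathbb{E}(D,V^X)$ such that the map $\mathrm{Hom}_{\mathcal{C}}(V^X,V)\to\mathbb{E}(D,V)$, $g\mapsto g\cdot\eta$, is surjective. Then (a)$\Rightarrow$(b) and (b)$\Leftrightarrow$(c). Moreover, if $\mathcal{C}$ is product-compatible, then (a), (b) and (c) are equivalent.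
   Context: **Extriangulated categories (Nakaoka–Palu).** An extriangulated category is a triple $(\mathcal{C},\mathbb{E},\mathfrak{s})$: $\mathcal{C}$ is an additive category, $\mathbb{E}:\mathcal{C}^{op}\times\mathcal{C}\to\mathrm{Ab}$ is an additive bifunctor (for $\delta\in\mathbb{E}(C,A)$, $a:A\to A'$, $c:C'\to C$ write $a\cdot\delta=\mathbb{E}(C,a)(\delta)$, $\delta\cdot c=\mathbb{E}(c,A)(\delta)$), and $\mathfrak{s}$ assigns to each $\delta\in\mathbb{E}(C,A)$ an equivalence class $\mathfrak{s}(\delta)=[A\xrightarrow{x}B\xrightarrow{y}C]$ (two sequences are equivalent if there is an isomorphism of middle terms compatible with the identities of $A$ and $C$), subject to: (i) $\mathfrak{s}(0)=[A\to A\oplus C\to C]$ (canonical maps) and $\mathfrak{s}(\delta\oplus\delta')=\mathfrak{s}(\delta)\oplus\mathfrak{s}(\delta')$; (ii) if $\mathfrak{s}(\delta)=[A\xrightarrow{x}B\xrightarrow{y}C]$, $\mathfrak{s}(\delta')=[A'\xrightarrow{x'}B'\xrightarrow{y'}C']$ and $a:A\to A'$, $c:C\to C'$ satisfy $a\cdot\delta=\delta'\cdot c$, there is $b:B\to B'$ with $bx=x'a$, $y'b=cy$; (iii) (ET3) in the same notation, if $bx=x'a$ there is $c$ with $cy=y'b$ and $a\cdot\delta=\delta'\cdot c$, and dually (ET3$^{op}$); (iv) (ET4) if $\mathfrak{s}(\delta)=[A\xrightarrow{f}B\xrightarrow{f'}D]$ and $\mathfrak{s}(\delta')=[B\xrightarrow{g}C\xrightarrow{g'}F]$,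 there are $\delta''\in\mathbb{E}(E,A)$ with $\mathfrak{s}(\delta'')=[A\xrightarrow{gf}C\xrightarrow{h'}E]$ and morphisms $d:D\to E$, $e:E\to F$ with $df'=h'g$, $eh'=g'$, $\mathfrak{s}(f'\cdot\delta')=[D\xrightarrow{d}E\xrightarrow{e}F]$, $\delta''\cdot d=\delta$, $f\cdot\delta''=\delta'\cdot e$, and dually (ET4$^{op}$). If $\mathfrak{s}(\delta)=[A\xrightarrow{x}B\xrightarrow{y}C]$, the sequence realizes $\delta$. **AET3*, AET4*.** $\mathcal{C}$ is AET3* (has products) if every family of objects indexed by a non-empty set has a product; $A^I$ is the product of $I$ copies of $A$ and $\pi_i$ are canonical projections. $\mathcal{C}$ is AET4* if $\mathcal{C}^{op}$ is AET4; explicitly, if it is AET3* and for each non-empty set $I$ there is a natural transformation of $\mathrm{Ab}$-valued functors (natural in $A$ and $\{B_i\}_{i\in I}$) $\Gamma:\prod_{i\in I}\mathbb{E}(A,B_i)\to\mathbb{E}(A^I,\prod_{i\in I}B_i)$ such that (1) if $\eta_i$ is realized by $B_i\xrightarrow{f_i}E_i\xrightarrow{g_i}A$ for all $i$, then $\Gamma(\eta_i)_{i\in I}$ is realized by $\prod B_i\xrightarrow{\prod f_i}\prod E_i\xrightarrow{\prod g_i}A^I$; (2) $\pi_j^B\cdot\Gamma(\eta_i)_{i\in I}=\eta_j\cdot\pi_j^A$ for all $j\in I$. **Negative first extension.** An extriangulated category with negative first extension is one equipped with an additive bifunctor $\mathbb{E}^{-1}:\mathcal{C}^{op}\times\mathcal{C}\to\mathrm{Ab}$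 and, for each $\delta\in\mathbb{E}(C,A)$, natural transformations $\mathbb{E}^{-1}(-,C)\to\mathrm{Hom}_{\mathcal{C}}(-,A)$ and $\mathbb{E}^{-1}(A,-)\to\mathrm{Hom}_{\mathcal{C}}(C,-)$ such that, whenever $\mathfrak{s}(\delta)=[A\to B\to C]$ and $W\in\mathcal{C}$, the sequences $\mathbb{E}^{-1}(W,A)\to\mathbb{E}^{-1}(W,B)\to\mathbb{E}^{-1}(W,C)\to\mathrm{Hom}(W,A)\to\mathrm{Hom}(W,B)$ and $\mathbb{E}^{-1}(C,W)\to\mathbb{E}^{-1}(B,W)\to\mathbb{E}^{-1}(A,W)\to\mathrm{Hom}(C,W)\to\mathrm{Hom}(B,W)$ are exact. **Product-compatible.** $\mathcal{C}$ is product-compatible if it is an AET3* extriangulated category with negative first extension and, for every $X\in\mathcal{C}$, every set $I\neq\emptyset$ and every family $\{Y_i\}_{i\in I}$, the map $\mathbb{E}^{-1}(X,\prod_{i\in I}Y_i)\to\prod_{i\in I}\mathbb{E}^{-1}(X,Y_i)$, $\chi\mapsto(\mathbb{E}^{-1}(X,\pi_i^Y)(\chi))_{i\in I}$, is surjective.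
   Formalization: In the ''moreover'' clause it is also assumed that the maps E^{-1}(-,C)→Hom(-,A) are natural in the extension: if a·δ=δ'·c, then a composed with the map of δ equals the map of δ' after E^{-1}(-,c). Without this the clause is false. *)

(* Defs.v *)
From mathcomp Require Import all_boot all_algebra.

Set Implicit Arguments.
Unset Strict Implicit.
Unset Printing Implicit Defensive.

Import GRing.Theory.
Local Open Scope ring_scope.

Reserved Notation "g \oc f" (at level 40, left associativity).
Reserved Notation "a *> d" (at level 45, right associativity).
Reserved Notation "d <* c" (at level 44, left associativity).

Record additive_category := AdditiveCategory {
  obj :> Type;
  mor : obj -> obj -> zmodType;
  idm : forall X, mor X X;
  compm : forall X Y Z, mor Y Z -> mor X Y -> mor X Z;
  comp1m : forall X Y (f : mor X Y), compm (idm Y) f = f;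
  compm1 : forall X Y (f : mor X Y), compm f (idm X) = f;
  compmA : forall X Y Z T (h : mor Z T) (g : mor Y Z) (f : mor X Y),
    compm h (compm g f) = compm (compm h g) f;
  compmDl : forall X Y Z (g g' : mor Y Z) (f : mor X Y),
    compm (g + g') f = compm g f + compm g' f;
  compmDr : forall X Y Z (g : mor Y Z) (f f' : mor X Y),
    compm g (f + f') = compm g f + compm g f';
  zero_obj : obj;
  from_zero_obj : forall X (f : mor zero_obj X), f = 0;
  to_zero_obj : forall X (f : mor X zero_obj), f = 0;
  osum : obj -> obj -> obj;
  in1 : forall X Y, mor X (osum X Y);
  in2 : forall X Y, mor Y (osum X Y);
  pr1 : forall X Y, mor (osum X Y) X;
  pr2 : forall X Y, mor (osum X Y) Y;
  pr1_in1 : forall X Y, compm (pr1 X Y) (in1 X Y) = idm X;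
  pr2_in2 : forall X Y, compm (pr2 X Y) (in2 X Y) = idm Y;
  pr2_in1 : forall X Y, compm (pr2 X Y) (in1 X Y) = 0;
  pr1_in2 : forall X Y, compm (pr1 X Y) (in2 X Y) = 0;
  osum_id : forall X Y,
    compm (in1 X Y) (pr1 X Y) + compm (in2 X Y) (pr2 X Y) = idm (osum X Y)
}.

Notation "g \oc f" := (compm g f) : ring_scope.

Definition is_iso (C : additive_category) (X Y : C) (f : mor X Y) : Prop :=
  exists g : mor Y X, g \oc f = idm X /\ f \oc g = idm Y.

Definition osum_map (C : additive_category) (X X' Y Y' : C)
    (f : mor X Y) (g : mor X' Y') : mor (osum X X') (osum Y Y') :=
  in1 Y Y' \oc f \oc pr1 X X' + in2 Y Y' \oc g \oc pr2 X X'.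

(* [F X A] is contravariant in [X] and covariant in [A]. *)
Record additive_bifunctor (C : additive_category) := AdditiveBifunctor {
  bif_ob :> C -> C -> zmodType;
  push : forall X A A', mor A A' -> bif_ob X A -> bif_ob X A';
  pull : forall X X' A, bif_ob X A -> mor X' X -> bif_ob X' A;
  push1 : forall X A (d : bif_ob X A), push (idm A) d = d;
  pull1 : forall X A (d : bif_ob X A), pull d (idm X) = d;
  push_comp : forall X A A' A'' (a' : mor A' A'') (a : mor A A')
    (d : bif_ob X A), push (a' \oc a) d = push a' (push a d);
  pull_comp : forall X X' X'' A (d : bif_ob X A) (c : mor X' X)
    (c' : mor X'' X'), pull d (c \oc c') = pull (pull d c) c';
  push_pull : forall X X' A A' (a : mor A A') (d : bif_ob X A) (c : mor X' X),
    push a (pull d c) = pull (push a d) c;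
  pushDr : forall X A A' (a : mor A A') (d d' : bif_ob X A),
    push a (d + d') = push a d + push a d';
  pullDl : forall X X' A (d d' : bif_ob X A) (c : mor X' X),
    pull (d + d') c = pull d c + pull d' c;
  pushDl : forall X A A' (a a' : mor A A') (d : bif_ob X A),
    push (a + a') d = push a d + push a' d;
  pullDr : forall X X' A (d : bif_ob X A) (c c' : mor X' X),
    pull d (c + c') = pull d c + pull d c'
}.

Notation "a *> d" := (push a d) : ring_scope.
Notation "d <* c" := (pull d c) : ring_scope.

(* [s d x y] says that the sequence A -x-> B -y-> X belongs to the class
   s(d), where d : E X A. *)
Definition realization (C : additive_category) (E : additive_bifunctor C) :=
  forall (A X : C), E X A -> forall B : C, mor A B -> mor B X -> Prop.

Definition seq_equiv (C : additive_category) (A B B' X : C)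
    (x : mor A B) (y : mor B X) (x' : mor A B') (y' : mor B' X) : Prop :=
  exists b : mor B B', [/\ is_iso b, b \oc x = x' & y' \oc b = y].

(* The direct sum of two extensions, as an element of E (X + X') (A + A'). *)
Definition esum (C : additive_category) (E : additive_bifunctor C)
    (A X A' X' : C) (d : E X A) (d' : E X' A') : E (osum X X') (osum A A') :=
  in1 A A' *> d <* pr1 X X' + in2 A A' *> d' <* pr2 X X'.

Section Extriangulation.

Variables (C : additive_category) (E : additive_bifunctor C).
Variable s : realization E.

Definition is_class_map : Prop :=
  forall (A X : C) (d : E X A),
    (exists (B : C) (x : mor A B) (y : mor B X), s d x y) /\
    (forall (B : C) (x : mor A B) (y : mor B X), s d x y ->
     forall (B' : C) (x' : mor A B') (y' : mor B' X),
       s d x' y' <-> seq_equiv x y x' y').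

Definition realizes_zero : Prop :=
  forall A X : C, s (0 : E X A) (in1 A X) (pr2 A X).

Definition realizes_sum : Prop :=
  forall (A B X : C) (d : E X A) (x : mor A B) (y : mor B X)
         (A' B' X' : C) (d' : E X' A') (x' : mor A' B') (y' : mor B' X'),
    s d x y -> s d' x' y' -> s (esum d d') (osum_map x x') (osum_map y y').

Definition realizes_morphism : Prop :=
  forall (A B X : C) (d : E X A) (x : mor A B) (y : mor B X)
         (A' B' X' : C) (d' : E X' A') (x' : mor A' B') (y' : mor B' X')
         (a : mor A A') (c : mor X X'),
    s d x y -> s d' x' y' -> a *> d = d' <* c ->
    exists b : mor B B', b \oc x = x' \oc a /\ y' \oc b = c \oc y.

Definition ET3 : Prop :=
  forall (A B X : C) (d : E X A) (x : mor A B) (y : mor B X)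
         (A' B' X' : C) (d' : E X' A') (x' : mor A' B') (y' : mor B' X')
         (a : mor A A') (b : mor B B'),
    s d x y -> s d' x' y' -> b \oc x = x' \oc a ->
    exists c : mor X X', c \oc y = y' \oc b /\ a *> d = d' <* c.

Definition ET3op : Prop :=
  forall (A B X : C) (d : E X A) (x : mor A B) (y : mor B X)
         (A' B' X' : C) (d' : E X' A') (x' : mor A' B') (y' : mor B' X')
         (b : mor B B') (c : mor X X'),
    s d x y -> s d' x' y' -> y' \oc b = c \oc y ->
    exists a : mor A A', b \oc x = x' \oc a /\ a *> d = d' <* c.

Definition ET4 : Prop :=
  forall (A B D X F : C) (d : E D A) (f : mor A B) (f' : mor B D)
         (d' : E F B) (g : mor B X) (g' : mor X F),
    s d f f' -> s d' g g' ->
    exists (G : C) (d'' : E G A) (h' : mor X G) (u : mor D G) (v : mor G F),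
      [/\ s d'' (g \oc f) h',
          u \oc f' = h' \oc g /\ v \oc h' = g',
          s (f' *> d') u v,
          d'' <* u = d
        & f *> d'' = d' <* v].

(* [ET4] read in the opposite category, where the arrows and the arguments of
   [E] are exchanged. *)
Definition ET4op : Prop :=
  forall (A B D X F : C) (d : E A D) (f : mor B A) (f' : mor D B)
         (d' : E B F) (g : mor X B) (g' : mor F X),
    s d f' f -> s d' g' g ->
    exists (G : C) (d'' : E A G) (h' : mor G X) (u : mor G D) (v : mor F G),
      [/\ s d'' h' (f \oc g),
          f' \oc u = g \oc h' /\ h' \oc v = g',
          s (d' <* f') v u,
          u *> d'' = d
        & d'' <* f = v *> d'].

End Extriangulation.

Record extriangulated_category := ExtriangulatedCategory {
  etcat :> additive_category;
  ext : additive_bifunctor etcat;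
  realizes : realization ext;
  realizes_class : is_class_map realizes;
  realizes0 : realizes_zero realizes;
  realizesD : realizes_sum realizes;
  realizes_mor : realizes_morphism realizes;
  et3 : ET3 realizes;
  et3op : ET3op realizes;
  et4 : ET4 realizes;
  et4op : ET4op realizes
}.

Arguments ext {_}.
Arguments realizes {_} [A X] _ [B] _ _.

(* A non-empty set. The explicit universe is the one in which the carriers of
   [zmodType]s live, so that an index set has the same size as a Hom-set. *)
Record index_set := IndexSet {
  carrier :> Type@{Algebra.Zmodule.axioms_.u0};
  carrier_inhabited : inhabited carrier
}.

(* A choice of a product for every family indexed by a non-empty set. *)
Record products (C : additive_category) := Products {
  prod_obj : forall I : index_set, (I -> C) -> C;
  proj : forall (I : index_set) (B : I -> C) (i : I), mor (prod_obj B) (B i);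
  prod_lift : forall (I : index_set) (B : I -> C) (X : C),
    (forall i, mor X (B i)) -> mor X (prod_obj B);
  proj_lift : forall (I : index_set) (B : I -> C) (X : C)
    (f : forall i, mor X (B i)) (i : I), proj B i \oc prod_lift f = f i;
  prod_lift_unique : forall (I : index_set) (B : I -> C) (X : C)
    (f : forall i, mor X (B i)) (h : mor X (prod_obj B)),
    (forall i, proj B i \oc h = f i) -> h = prod_lift f
}.

Definition prod_map (C : additive_category) (P : products C) (I : index_set)
    (B B' : I -> C) (f : forall i, mor (B i) (B' i)) :
    mor (prod_obj P B) (prod_obj P B') :=
  prod_lift P (fun i => f i \oc proj P B i).

Definition power (C : additive_category) (P : products C) (I : index_set)
    (A : C) : C :=
  prod_obj P (fun _ : I => A).

Definition power_proj (C : additive_category) (P : products C) (I : index_set)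
    (A : C) (i : I) : mor (power P I A) A :=
  proj P (fun _ : I => A) i.

Definition power_map (C : additive_category) (P : products C) (I : index_set)
    (A A' : C) (a : mor A A') : mor (power P I A) (power P I A') :=
  prod_map P (fun _ : I => a).

Section Statements.

Variables (C : extriangulated_category) (P : products C).

Definition AET4star : Prop :=
  forall I : index_set,
  exists Gamma : forall (A : C) (B : I -> C),
    (forall i, ext A (B i)) -> ext (power P I A) (prod_obj P B),
  [/\ forall (A : C) (B : I -> C) (e e' : forall i, ext A (B i)),
        Gamma A B (fun i => e i + e' i) = Gamma A B e + Gamma A B e',
      forall (A A' : C) (B : I -> C) (e : forall i, ext A (B i))
             (a : mor A' A),
        Gamma A' B (fun i => e i <* a) = Gamma A B e <* power_map P I a,
      forall (A : C) (B B' : I -> C) (e : forall i, ext A (B i))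
             (b : forall i, mor (B i) (B' i)),
        Gamma A B' (fun i => b i *> e i) = prod_map P b *> Gamma A B e,
      forall (A : C) (B F : I -> C) (e : forall i, ext A (B i))
             (f : forall i, mor (B i) (F i)) (g : forall i, mor (F i) A),
        (forall i, realizes (e i) (f i) (g i)) ->
        realizes (Gamma A B e) (prod_map P f) (prod_map P g)
    & forall (A : C) (B : I -> C) (e : forall i, ext A (B i)) (j : I),
        proj P B j *> Gamma A B e = e j <* power_proj P A j].

Definition tau (I : index_set) (A : C) (B : I -> C)
    (e : ext A (prod_obj P B)) : forall i, ext A (B i) :=
  fun i => proj P B i *> e.

(* [tau] is an isomorphism of Ab-valued functors in A and (B_i). *)
Definition tau_natural_iso : Prop :=
  forall I : index_set,
  [/\ forall (A : C) (B : I -> C) (e e' : ext A (prod_obj P B)) (i : I),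
        tau (e + e') i = tau e i + tau e' i,
      forall (A A' : C) (B : I -> C) (e : ext A (prod_obj P B))
             (a : mor A' A) (i : I),
        tau (e <* a) i = tau e i <* a,
      forall (A : C) (B B' : I -> C) (e : ext A (prod_obj P B))
             (b : forall i, mor (B i) (B' i)) (i : I),
        tau (prod_map P b *> e) i = b i *> tau e i
    & forall (A : C) (B : I -> C), bijective (@tau I A B)].

Definition universal_coextension (V D : C) (X : index_set)
    (e : ext D (power P X V)) : Prop :=
  forall d : ext D V, exists g : mor (power P X V) V, g *> e = d.

Definition has_universal_coextensions : Prop :=
  forall V D : C, exists (X : index_set) (e : ext D (power P X V)),
    universal_coextension e.

End Statements.

Definition exact_at (U V W : zmodType) (f : U -> V) (g : V -> W) : Prop :=
  forall v : V, (exists u : U, f u = v) <-> g v = 0.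

Record negative_first_extension (C : extriangulated_category) :=
    NegativeFirstExtension {
  negext :> additive_bifunctor C;
  (* E^{-1}(-, X) -> Hom(-, A) and E^{-1}(A, -) -> Hom(X, -) for d : ext X A *)
  conn1 : forall (A X : C) (d : ext X A) (W : C), negext W X -> mor W A;
  conn2 : forall (A X : C) (d : ext X A) (W : C), negext A W -> mor X W;
  conn1D : forall (A X : C) (d : ext X A) (W : C) (k k' : negext W X),
    conn1 d (k + k') = conn1 d k + conn1 d k';
  conn2D : forall (A X : C) (d : ext X A) (W : C) (k k' : negext A W),
    conn2 d (k + k') = conn2 d k + conn2 d k';
  conn1_nat : forall (A X : C) (d : ext X A) (W W' : C) (k : negext W X)
    (w : mor W' W), conn1 d (k <* w) = conn1 d k \oc w;
  conn2_nat : forall (A X : C) (d : ext X A) (W W' : C) (k : negext A W)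
    (w : mor W W'), conn2 d (w *> k) = w \oc conn2 d k;
  conn1_exact : forall (A B X : C) (d : ext X A) (x : mor A B) (y : mor B X),
    realizes d x y -> forall W : C,
    [/\ exact_at (fun k : negext W A => x *> k) (fun k : negext W B => y *> k),
        exact_at (fun k : negext W B => y *> k) (@conn1 A X d W)
      & exact_at (@conn1 A X d W) (fun h : mor W A => x \oc h)];
  conn2_exact : forall (A B X : C) (d : ext X A) (x : mor A B) (y : mor B X),
    realizes d x y -> forall W : C,
    [/\ exact_at (fun k : negext X W => k <* y) (fun k : negext B W => k <* x),
        exact_at (fun k : negext B W => k <* x) (@conn2 A X d W)
      & exact_at (@conn2 A X d W) (fun h : mor X W => h \oc y)]
}.

(* The first connecting map is natural in the extension too. The record above
   only asks for naturality in W, and with that alone AET4* does not follow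
   from [tau_natural_iso]. A counterexample: let R, F : Vect^op -> Vect over a
   countable field k be R D = k^(N) (x) D^* and F D = Hom (D, k^(N)); R D and
   F D are isomorphic for each D, but only F turns all sums into products. Let
   M be the additive category with objects S_D, B_D, Z_U and
     M(S_D, S_D') = M(S_D, B_D') = M(B_D, B_D') = Hom (D', D),
     M(Z_U, S_D) = M(Z_U, B_D) = Hom (U, R D),  M(Z_U, Z_U') = Hom (U, U'),
   all other Hom groups being 0. In the category of complexes over M, up to
   homotopy, take the sums of S_D[1], B_D, Z_U and the cones of S_D -> B_D,
   with E^{-1} equal to Hom (U, F D) at (Z_U, S_D[1]) and 0 elsewhere. *)
Definition connecting_natural (C : extriangulated_category)
    (N : negative_first_extension C) : Prop :=
  forall (A X A' X' : C) (d : ext X A) (d' : ext X' A')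
         (a : mor A A') (c : mor X X'),
    a *> d = d' <* c ->
    forall (W : C) (k : N W X), a \oc conn1 d k = conn1 d' (c *> k).

Definition product_compatible (C : extriangulated_category) (P : products C)
    (N : negative_first_extension C) : Prop :=
  forall (X : C) (I : index_set) (Y : I -> C) (k : forall i, N X (Y i)),
    exists k' : N X (prod_obj P Y), forall i, proj P Y i *> k' = k i.

(* Main.v *)
Require Import Defs.
From mathcomp Require Import all_boot all_algebra boolp.

(** An extension whose inflation has a retraction is zero, and a morphism
    extends along the inflation of [d] as soon as it kills [d]. So if all the
    components of an extension of A by a product vanish, the projections of the
    product extend to its middle term and assemble into a retraction: [tau] is
    injective in every extriangulated category with products
    ([tau_injective]), and (b) only asks that every family of extensions be
    the family of components of one extension.

    (a) => (b): the pullback of [Gamma e] along the diagonal of A has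
    components e.

    (b) => (c): the family of all the elements of E(D, V), indexed by E(D, V)
    itself, comes from one extension, and its projections recover each element.

    (c) => (b): a family e_i in E(A, B_i) is carried by the coordinate
    inclusions to a family in E(A, V), with V the product of the B_i. If a
    universal extension is pushed to the i-th of them by g_i, the morphism with
    components pi_i g_i pushes it to an extension with components e_i.

    (b) => (a), under product-compatibility: [Gamma e] is the only extension
    whose components are the e_i <* pi_i; uniqueness gives additivity and
    naturality. Concerning the realization of [Gamma e], let F be its middle
    term and F_i that of e_i. Lifting the projections gives a comparison
    F -> prod F_i, an isomorphism by the argument of the five lemma applied to
    Hom(W, -). Surjectivity uses the injectivity of [tau]
    ([comparison_split_epi]). Injectivity uses the term E^{-1}(W, A), where
    families of elements lift to E^{-1}(W, A^I) by product-compatibility, and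
    the naturality of the connecting map ([comparison_mono]). *)

Set Implicit Arguments.
Unset Strict Implicit.
Unset Printing Implicit Defensive.

Import GRing.Theory.
Local Open Scope ring_scope.

(** * Additive preliminaries *)

Section Additive.

Variable C : additive_category.

Lemma compm0 (X Y Z : C) (g : mor Y Z) : g \oc (0 : mor X Y) = 0.
Proof. by apply: (addIr (g \oc 0)); rewrite -compmDr !add0r. Qed.

Lemma comp0m (X Y Z : C) (f : mor X Y) : (0 : mor Y Z) \oc f = 0.
Proof. by apply: (addIr (0 \oc f)); rewrite -compmDl !add0r. Qed.

Lemma compmN (X Y Z : C) (g : mor Y Z) (f : mor X Y) : g \oc (- f) = - (g \oc f).
Proof. by apply: (addIr (g \oc f)); rewrite -compmDr !addNr compm0. Qed.

Lemma compmBr (X Y Z : C) (g : mor Y Z) (f f' : mor X Y) :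
  g \oc (f - f') = g \oc f - g \oc f'.
Proof. by rewrite compmDr compmN. Qed.

Variable F : additive_bifunctor C.

Lemma push0 (X A A' : C) (a : mor A A') : a *> (0 : F X A) = 0.
Proof. by apply: (addIr (a *> 0)); rewrite -pushDr !add0r. Qed.

Lemma pull0 (X X' A : C) (c : mor X' X) : (0 : F X A) <* c = 0.
Proof. by apply: (addIr (0 <* c)); rewrite -pullDl !add0r. Qed.

Lemma pushN (X A A' : C) (a : mor A A') (d : F X A) : a *> (- d) = - (a *> d).
Proof. by apply: (addIr (a *> d)); rewrite -pushDr !addNr push0. Qed.

End Additive.

Section Products.

Variables (C : additive_category) (P : products C).

Lemma prod_mor_ext (I : index_set) (B : I -> C) (X : C)
    (h h' : mor X (prod_obj P B)) :
  (forall i, proj P B i \oc h = proj P B i \oc h') -> h = h'.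
Proof.
move=> hh'; rewrite (prod_lift_unique hh').
by rewrite -(@prod_lift_unique _ P I B X _ h').
Qed.

Lemma proj_prod_map (I : index_set) (B B' : I -> C)
    (f : forall i, mor (B i) (B' i)) (i : I) :
  proj P B' i \oc prod_map P f = f i \oc proj P B i.
Proof. exact: proj_lift. Qed.

(** In an additive category a product retracts onto each factor: the section is
    the identity at i and zero at the other indices, told apart by excluded
    middle. *)
Lemma coordinate_inclusion (I : index_set) (B : I -> C) (i : I) :
  exists u : mor (B i) (prod_obj P B), proj P B i \oc u = idm (B i).
Proof.
pose f j : mor (B i) (B j) :=
  if pselect (i = j) is left ij then eq_rect i (fun k => mor (B i) (B k)) (idm (B i)) j ij
  else 0.
exists (prod_lift P f); rewrite proj_lift /f.
by case: pselect => // ii; rewrite (Prop_irrelevance ii erefl).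
Qed.

End Products.

(** * Exact sequences of an extriangulated category *)

Section Exactness.

Variable C : extriangulated_category.

(** As [a] kills [d], it extends to a morphism from the sequence of [d] to the
    split sequence Y -> Y + X -> X, whose middle term retracts onto Y. *)
Lemma extend_along_inflation (A B X Y : C) (d : ext X A) (x : mor A B)
    (y : mor B X) (a : mor A Y) :
  realizes d x y -> a *> d = 0 -> exists r : mor B Y, r \oc x = a.
Proof.
move=> dxy ad0.
have ad : a *> d = (0 : ext X Y) <* idm X by rewrite pull0.
have [b [bx _]] := realizes_mor dxy (realizes0 Y X) ad.
by exists (pr1 Y X \oc b); rewrite -compmA bx compmA pr1_in1 comp1m.
Qed.

(** Dually, the split sequence A -> A + W -> W maps to that of [d] over [v]. *)
Lemma lift_along_deflation (A B X W : C) (d : ext X A) (x : mor A B)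
    (y : mor B X) (v : mor W X) :
  realizes d x y -> d <* v = 0 -> exists u : mor W B, y \oc u = v.
Proof.
move=> dxy dv0.
have dv : idm A *> (0 : ext W A) = d <* v by rewrite push0.
have [b [_ yb]] := realizes_mor (realizes0 A W) dxy dv.
by exists (b \oc in2 A W); rewrite compmA yb -compmA pr2_in2 compm1.
Qed.

(** The retraction gives a morphism to the sequence A -> A + 0 -> 0 that is the
    identity on A. *)
Lemma ext_eq0_of_retraction (A B X : C) (d : ext X A) (x : mor A B)
    (y : mor B X) (r : mor B A) :
  realizes d x y -> r \oc x = idm A -> d = 0.
Proof.
move=> dxy rx.
have rx' : (in1 A (zero_obj C) \oc r) \oc x = in1 A (zero_obj C) \oc idm A.
  by rewrite -compmA rx.
have [c [_ dc]] := et3 dxy (realizes0 A (zero_obj C)) rx'.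
by rewrite -(push1 d) dc pull0.
Qed.

(** The sequence 0 -> 0 + B -> B maps to the one that realizes [d]. *)
Lemma pull_deflation (A B X : C) (d : ext X A) (x : mor A B) (y : mor B X) :
  realizes d x y -> d <* y = 0.
Proof.
move=> dxy.
have [a [_ <-]] := et3op (realizes0 (zero_obj C) B) dxy
  (erefl (y \oc pr2 (zero_obj C) B)).
exact: push0.
Qed.

(** The sequence W -> W + 0 -> 0 maps to the one that realizes [d]. *)
Lemma factor_through_inflation (A B X W : C) (d : ext X A) (x : mor A B)
    (y : mor B X) (v : mor W B) :
  realizes d x y -> y \oc v = 0 -> exists w : mor W A, x \oc w = v.
Proof.
move=> dxy yv0.
have yv : y \oc (v \oc pr1 W (zero_obj C)) = 0 \oc pr2 W (zero_obj C).
  by rewrite compmA yv0 !comp0m.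
have [w [vw _]] := et3op (realizes0 W (zero_obj C)) dxy yv.
by exists w; rewrite -vw -compmA pr1_in1 compm1.
Qed.

End Exactness.

(** * Components of an extension by a product *)

Section Components.

Variables (C : extriangulated_category) (P : products C).

Lemma tau_eq0 (I : index_set) (A : C) (B : I -> C) (e : ext A (prod_obj P B)) :
  (forall i, proj P B i *> e = 0) -> e = 0.
Proof.
move=> e0.
have [[F [x [y exy]]] _] := realizes_class e.
have retr i := cid (extend_along_inflation exy (e0 i)).
apply: (ext_eq0_of_retraction (r := prod_lift P (fun i => projT1 (retr i))) exy).
apply: prod_mor_ext => i.
by rewrite compmA proj_lift compm1; case: (retr i).
Qed.

Lemma tau_injective (I : index_set) (A : C) (B : I -> C)
    (e e' : ext A (prod_obj P B)) :
  (forall i, proj P B i *> e = proj P B i *> e') -> e = e'.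
Proof.
move=> ee'; apply/eqP; rewrite -subr_eq0; apply/eqP/tau_eq0 => i.
by rewrite pushDr pushN ee' subrr.
Qed.

Definition components_lift : Prop :=
  forall (I : index_set) (A : C) (B : I -> C) (e : forall i, ext A (B i)),
    exists e' : ext A (prod_obj P B), forall i, proj P B i *> e' = e i.

Lemma tau_natural_isoP : tau_natural_iso P <-> components_lift.
Proof.
split=> [iso I A B e | lift I].
  have [_ _ _ bij] := iso I.
  have [t _ tK] := bij A B.
  by exists (t e) => i; rewrite -[RHS](congr1 (fun e0 => e0 i) (tK e)).
split.
- by move=> A B e e' i; rewrite /tau pushDr.
- by move=> A A' B e a i; rewrite /tau push_pull.
- by move=> A B B' e b i; rewrite /tau -!push_comp proj_prod_map.
move=> A B; pose t e := projT1 (cid (lift I A B e)).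
have tP e i : proj P B i *> t e = e i by rewrite /t; case: cid.
exists t => e; first by apply: tau_injective => i; rewrite tP.
by apply: functional_extensionality_dep => i; rewrite /tau tP.
Qed.

Lemma components_lift_of_AET4star : AET4star P -> components_lift.
Proof.
move=> aet I A B e; have [Gamma [_ _ _ _ GammaP]] := aet I.
(* the diagonal of A *)
pose D : mor A (power P I A) := prod_lift P (fun _ => idm A).
exists (Gamma A B e <* D) => i.
by rewrite push_pull GammaP -pull_comp /power_proj proj_lift pull1.
Qed.

(** The family of all the elements of E(D, V), indexed by themselves, lifts to
    one extension, which the projections push to each of them. *)
Lemma universal_coextension_of_components_lift :
  components_lift -> has_universal_coextensions P.
Proof.
move=> lift V D.
pose I := IndexSet (inhabits (0 : ext D V)).
have [e eP] := lift I D (fun _ => V) (fun d => d).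
by exists I, e => d; exists (power_proj P V (d : I)); apply: eP.
Qed.

(** A universal extension by the product of the B_i can be pushed to each e_i at
    once, since every B_i is a retract of that product. *)
Lemma components_lift_of_universal_coextension :
  has_universal_coextensions P -> components_lift.
Proof.
move=> univ I A B e.
have incl i := cid (coordinate_inclusion P B i).
have [X [u uP]] := univ (prod_obj P B) A.
have g i := cid (uP (projT1 (incl i) *> e i)).
exists (prod_lift P (fun i => proj P B i \oc projT1 (g i)) *> u) => i.
rewrite -push_comp proj_lift push_comp (projT2 (g i)) -push_comp.
by rewrite (projT2 (incl i)) push1.
Qed.

End Components.

(** * The comparison with the product of the realizations *)

Section Comparison.

Variables (C : extriangulated_category) (P : products C).
Variables (I : index_set) (A : C) (B F : I -> C).
Variables (e : forall i, ext A (B i)).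
Variables (f : forall i, mor (B i) (F i)) (g : forall i, mor (F i) A).
Hypothesis efg : forall i, realizes (e i) (f i) (g i).
Variables (G : ext (power P I A) (prod_obj P B)).
Hypothesis GP : forall i, proj P B i *> G = e i <* power_proj P A i.
Variables (M : C) (x : mor (prod_obj P B) M) (y : mor M (power P I A)).
Hypothesis Gxy : realizes G x y.

Lemma comparison_exists : exists h : mor M (prod_obj P F),
  h \oc x = prod_map P f /\ prod_map P g \oc h = y.
Proof.
have hi i := cid (realizes_mor Gxy (efg i) (GP i)).
exists (prod_lift P (fun i => projT1 (hi i))).
split; apply: prod_mor_ext => i; rewrite compmA proj_prod_map.
  by rewrite proj_lift; case: (hi i) => ? [].
by rewrite -compmA proj_lift; case: (hi i) => ? [].
Qed.

Variable h : mor M (prod_obj P F).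
Hypothesis hx : h \oc x = prod_map P f.
Hypothesis gh : prod_map P g \oc h = y.

(** The surjectivity half of the five lemma, at the identity of the product of
    the middle terms: its image in A^I lifts to M because the pullback of [G]
    along it has zero components, and the error of the lift comes from the
    product of the B_i. *)
Lemma comparison_split_epi :
  exists t : mor (prod_obj P F) M, h \oc t = idm (prod_obj P F).
Proof.
have G0 : G <* prod_map P g = 0.
  apply: tau_eq0 => i.
  rewrite push_pull GP -pull_comp proj_prod_map pull_comp.
  by rewrite (pull_deflation (efg i)) pull0.
have [v yv] := lift_along_deflation Gxy G0.
have err i : g i \oc (proj P F i \oc (idm _ - h \oc v)) = 0.
  rewrite compmA -(proj_prod_map P g) -compmA compmBr compm1 compmA gh yv.
  by rewrite subrr compm0.
have w i := cid (factor_through_inflation (efg i) (err i)).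
exists (v + x \oc prod_lift P (fun i => projT1 (w i))).
suff fw : prod_map P f \oc prod_lift P (fun i => projT1 (w i)) = idm _ - h \oc v.
  by rewrite compmDr compmA hx fw addrC subrK.
apply: prod_mor_ext => i.
by rewrite compmA proj_prod_map -compmA proj_lift (projT2 (w i)).
Qed.

Variable N : negative_first_extension C.
Hypothesis N_nat : connecting_natural N.
Hypothesis N_prod : product_compatible P N.

(** The injectivity half of the five lemma: a morphism killed by [h] factors
    through [x] by some w. Each component of w comes from E^{-1}(W, A) since f_i
    kills it; the elements found there lift together to E^{-1}(W, A^I), so that
    w is in the image of the connecting map of [G], and [x] kills it. *)
Lemma comparison_mono (W : C) (v : mor W M) : h \oc v = 0 -> v = 0.
Proof.
move=> hv.
have [w xw] : exists w, x \oc w = v.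
  by apply: (factor_through_inflation Gxy); rewrite -gh -compmA hv compm0.
have fw i : f i \oc (proj P B i \oc w) = 0.
  by rewrite compmA -(proj_prod_map P f) -hx -!compmA xw hv compm0.
have ex_k i : exists k : N W A, conn1 (e i) k = proj P B i \oc w.
  by have [_ _ ex] := conn1_exact N (efg i) W; apply/ex.
have k i := cid (ex_k i).
have [k' k'P] := N_prod (Y := fun _ : I => A) (fun i => projT1 (k i)).
have wk : conn1 G k' = w.
  apply: prod_mor_ext => i.
  rewrite (N_nat (GP i)) -(projT2 (k i)); congr (conn1 (e i) _).
  exact: k'P.
have [_ _ ex] := conn1_exact N Gxy W.
by rewrite -xw; apply/ex; exists k'.
Qed.

Lemma comparison_iso : is_iso h.
Proof.
have [t ht] := comparison_split_epi.
exists t; split=> //; apply/eqP; rewrite -subr_eq0; apply/eqP/comparison_mono.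
by rewrite compmBr compmA ht comp1m compm1 subrr.
Qed.

End Comparison.

(** The extension whose components are the e_i <* pi_i satisfies the axioms by
    uniqueness; its realization is the product of those of the e_i, up to the
    comparison isomorphism. *)
Lemma AET4star_of_components_lift (C : extriangulated_category) (P : products C)
    (N : negative_first_extension C) :
  connecting_natural N -> product_compatible P N ->
  components_lift P -> AET4star P.
Proof.
move=> N_nat N_prod lift I.
pose Gamma A B (e : forall i, ext A (B i)) :=
  projT1 (cid (lift I (power P I A) B (fun i => e i <* power_proj P A i))).
have GammaP A B e i : proj P B i *> Gamma A B e = e i <* power_proj P A i.
  by rewrite /Gamma; case: cid.
exists Gamma; split=> //.
- move=> A B e e'; apply: tau_injective => i.
  by rewrite pushDr !GammaP pullDl.
- move=> A A' B e a; apply: tau_injective => i.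
  by rewrite push_pull !GammaP -!pull_comp /power_map /power_proj proj_prod_map.
- move=> A B B' e b; apply: tau_injective => i.
  by rewrite -push_comp proj_prod_map push_comp !GammaP push_pull.
move=> A B F e f g efg.
have [[M [x [y Gxy]]] equivP] := realizes_class (Gamma A B e).
have [h [hx gh]] := comparison_exists efg (GammaP A B e) Gxy.
apply/(equivP _ _ _ Gxy); exists h; split=> //.
exact: (comparison_iso efg (GammaP A B e) Gxy hx gh N_nat N_prod).
Qed.

Theorem theorem3p16 (C : extriangulated_category) (P : products C) :
  [/\ AET4star P -> tau_natural_iso P,
      tau_natural_iso P <-> has_universal_coextensions P
    & forall N : negative_first_extension C,
        connecting_natural N -> product_compatible P N ->
        [<-> AET4star P; tau_natural_iso P; has_universal_coextensions P]].
Proof.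
have ab : AET4star P -> tau_natural_iso P.
  by move/components_lift_of_AET4star/tau_natural_isoP.
have bc : tau_natural_iso P -> has_universal_coextensions P.
  by move/tau_natural_isoP/universal_coextension_of_components_lift.
split=> //.
  by split=> // /components_lift_of_universal_coextension/tau_natural_isoP.
move=> N N_nat N_prod; tfae=> //.
move/components_lift_of_universal_coextension.
exact: AET4star_of_components_lift N_nat N_prod.
Qed.
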